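(* Let $d\ge 1$, $0<\rho<\pi$, $\tau_i=\frac{(i-1/2)\pi}{d}$ for $i=1,\dots,d$, and let $s_i=[\cos(\tau_i+\rho),\cos(\tau_i-\rho)]$. Let $V_d\in\mathbb{R}^{d\times d}$ be the matrix with entries $$[V_d]_{i,j}=\int_{s_i}U_{j-1}(x)\,\mathrm{d}x=\frac{2}{j}\sin(j\tau_i)\sin(j\rho),\qquad i,j=1,\dots,d.$$ Then the matrix $V_d^\top V_d$ is diagonal, and its $i$-th diagonal term is $$[V_d^\top V_d]_{i,i}=\begin{cases}\frac{2d}{i^2}\sin^2(i\rho) & \text{if } i=1,\dots,d-1,\\[2pt] \frac{4d}{i^2}\sin^2(i\rho) & \text{if } i=d.\end{cases}$$
   Context: $U_{j-1}(x)=\frac{\sin(j\arccos x)}{\sin(\arccos x)}$ is the Chebyshev polynomial of the second kind of degree $j-1$. *)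

(* Defs.v *)
From HB Require Import structures.
From mathcomp Require Import all_boot all_order all_algebra.
From mathcomp Require Import all_classical all_reals all_analysis.
Set Implicit Arguments.
Unset Strict Implicit.
Unset Printing Implicit Defensive.
Import Order.TTheory GRing.Theory Num.Theory.
Local Open Scope classical_set_scope.
Local Open Scope ring_scope.

(* The trigonometric formula is 0 / 0 = 0 at x = 1 and x = -1, where the
   polynomial takes other values; see chebyshevU_poly for the open interval.
   These two points are Lebesgue-null, so integrals do not depend on them. *)
Definition chebyshevU (R : realType) (n : nat) (x : R) : R :=
  sin (n.+1%:R * acos x) / sin (acos x).

Lemma chebyshevU_poly (R : realType) (n : nat) :
  exists p : {poly R}, size p = n.+1 /\
    forall x : R, -1 < x < 1 -> chebyshevU n x = p.[x].
Proof.
pose good m (p : {poly R}) := size p = m.+1 /\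
  forall x : R, -1 < x < 1 -> chebyshevU m x = p.[x].
have s0 (x : R) : -1 < x < 1 -> sin (acos x) != 0.
  move=> /andP[x1 x2]; rewrite gt_eqF // sin_gt0_pi //.
  by rewrite acos_gt0 ?acos_ltpi // ?x1 ?x2 ?ltW.
have ca (x : R) : -1 < x < 1 -> cos (acos x) = x.
  by move=> /andP[x1 x2]; apply: acosK; rewrite in_itv /= !ltW.
suff [p [q []]] : exists p q, good n p /\ good n.+1 q by exists p.
elim: n => [|n [p [q [[sp hp] [sq hq]]]]].
  exists 1, ('X *+ 2); split; split.
  - by rewrite size_poly1.
  - by move=> x hx; rewrite /chebyshevU mul1r divff ?s0 // hornerC.
  - by rewrite -mulr_natr -polyC_natr mulrC mul_polyC size_scale ?size_polyX ?pnatr_eq0.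
  - move=> x hx; rewrite /chebyshevU hornerMn hornerX mulr_natl sin_mulr2n ca //.
    by rewrite mulrnAl mulfK ?s0.
exists q, ('X * q *+ 2 - p); split; split => //.
- have sz : size ('X * q *+ 2) = n.+3.
    rewrite -mulr_natr -polyC_natr mulrC mul_polyC size_scale ?pnatr_eq0 //.
    by rewrite mulrC size_mulX ?sq // -size_poly_gt0 sq.
  by rewrite size_polyDl sz // size_polyN sp.
- move=> x hx; rewrite hornerD hornerN hornerMn mulrC hornerMX -hp // -hq //.
  rewrite /chebyshevU.
  set t := acos x; have -> : x = cos t by rewrite /t ca.
  have -> : n.+3%:R * t = n.+2%:R * t + t by rewrite -natr1 mulrDl mul1r.
  have -> : n.+1%:R * t = n.+2%:R * t - t by rewrite -[n.+2%:R]natr1 mulrDl mul1r addrK.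
  rewrite sinD sinB mulrAC -mulrnAl -mulrBl; congr (_ / _).
  by rewrite mulr2n opprB -addrA; congr (_ + _); rewrite [RHS]addrC subrK.
Qed.

Definition tau (R : realType) (d i : nat) : R :=
  (i%:R - 1 / 2) * pi / d%:R.

Definition segment (R : realType) (d : nat) (rho : R) (i : nat) : set R :=
  `[cos (tau R d i + rho), cos (tau R d i - rho)].

(* Ordinals count from 0, whereas tau and segment are indexed from 1; the
   column of index j : 'I_d is the (j+1)-st and integrates U_j. *)
Definition V (R : realType) (d : nat) (rho : R) : 'M[R]_d :=
  \matrix_(i < d, j < d)
    \int[@lebesgue_measure R]_(x in segment d rho i.+1) chebyshevU j x.

(* Main.v *)
Require Import Defs.
From HB Require Import structures.
From mathcomp Require Import all_boot all_order all_algebra.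
From mathcomp Require Import all_classical all_reals all_analysis.
From mathcomp Require Import ring lra.
Set Implicit Arguments.
Unset Strict Implicit.
Unset Printing Implicit Defensive.
Import Order.TTheory GRing.Theory Num.Theory.
Import numFieldNormedType.Exports.
Local Open Scope ring_scope.

(** The primitive of [U_{j-1}] is [T_j / j], where [T_j] is the Chebyshev
    polynomial of the first kind, [T_j (cos t) = cos (j t)].  Hence the integral
    of [U_{j-1}] from [cos (tau_i + rho)] to [cos (tau_i - rho)] equals
    [(cos (j tau_i - j rho) - cos (j tau_i + j rho)) / j], which is the product
    formula for [V].  The primitive is a polynomial, so the computation stays
    valid when [tau_i - rho] or [tau_i + rho] leaves [0, pi]
    ([integral_chebyshevU]).

    By this formula column [j] of [V] is a multiple, independent of the row, of
    the vector [(sin (j tau_i))_i], so the Gram matrix of [V] reduces to that of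
    these vectors, the rows of a discrete sine transform.  Product-to-sum turns
    each of its entries into half a difference of two sums
    [\sum_i cos (m tau_i)] with [m] in [0, 2 d].  Such a sum telescopes to [0]
    after multiplication by [2 sin (m pi / (2 d))] when [0 < m < 2 d]
    ([sum_cos_tau]); it is [d] for [m = 0], and [- d] for [m = 2 d] since then
    each [m tau_i] is an odd multiple of [pi] ([sum_cos_tau_2d]).  The frequency
    [2 d] occurs only for the last diagonal entry, which is why that one has the
    exceptional factor. *)

(** Chebyshev polynomials of the first kind, specified on all of the reals
    rather than through [acos]: the later evaluation at [cos (tau_i + rho)]
    involves angles outside [0, pi]. *)
Lemma chebyshevT_exists (R : realType) (n : nat) :
  exists p : {poly R}, forall t : R, p.[cos t] = cos (n%:R * t).
Proof.
suff [p [q [hp _]]] : exists p q : {poly R},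
    (forall t : R, p.[cos t] = cos (n%:R * t)) /\
    (forall t : R, q.[cos t] = cos (n.+1%:R * t)) by exists p.
elim: n => [|n [p [q [hp hq]]]].
  exists 1, 'X; split=> t; first by rewrite hornerC mul0r cos0.
  by rewrite hornerX mul1r.
exists q, ('X * q *+ 2 - p); split=> // t.
rewrite hornerD hornerN hornerMn mulrC hornerMX hp hq.
have -> : n.+2%:R * t = n.+1%:R * t + t by rewrite -natr1 mulrDl mul1r.
have -> : n%:R * t = n.+1%:R * t - t by rewrite -natr1 mulrDl mul1r addrK.
rewrite cosB cosD; ring.
Qed.

(** Differentiating [T_n (cos t) = cos (n t)] gives
    [T_n' (cos t) sin t = n sin (n t)]. *)
Lemma deriv_chebyshevT (R : realType) (n : nat) (p : {poly R}) :
  (forall t : R, p.[cos t] = cos (n.+1%:R * t)) ->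
  forall x : R, -1 < x < 1 -> p^`().[x] = n.+1%:R * chebyshevU n x.
Proof.
move=> hp x /andP[x1 x2].
have s0 : sin (acos x) != 0.
  by rewrite gt_eqF // sin_gt0_pi // acos_gt0 ?acos_ltpi // ?x1 ?x2 ?ltW.
have xE : cos (acos x) = x by apply: acosK; rewrite in_itv /= !ltW.
rewrite /chebyshevU; set t := acos x in s0 xE *.
have dl : is_derive t 1 (horner p \o cos) (p^`().[cos t] * - sin t).
  exact: is_derive1_comp.
have dm : is_derive t 1 ( *%R n.+1%:R) (n.+1%:R : R).
  by have := is_deriveZ n.+1%:R (is_derive_id t 1); rewrite /GRing.scale /= mulr1.
have dr : is_derive t 1 (cos \o *%R n.+1%:R) (- sin (n.+1%:R * t) * n.+1%:R).
  exact: is_derive1_comp.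
have fE : horner p \o cos = cos \o *%R n.+1%:R.
  by apply/funext => y /=; rewrite hp.
rewrite fE in dl.
have := @derive_val _ _ _ _ _ _ _ dl.
rewrite (@derive_val _ _ _ _ _ _ _ dr) xE => e.
by apply: (mulIf s0); rewrite mulrA mulfVK //; lra.
Qed.

(** An endpoint may be [1] or [-1], where [chebyshevU n] is not the derivative of
    [T_{n+1} / (n+1)]; only the open interval matters for the integral. *)
Lemma integral_chebyshevU (R : realType) (n : nat) (s t : R) :
  cos s < cos t ->
  (\int[@lebesgue_measure R]_(x in `[cos s, cos t]%classic) chebyshevU n x)%R =
  (cos (n.+1%:R * t) - cos (n.+1%:R * s)) / n.+1%:R.
Proof.
move=> st; have [T hT] := chebyshevT_exists R n.+1.
pose P := n.+1%:R^-1 *: T.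
have UE x : x \in `]cos s, cos t[ -> chebyshevU n x = P^`().[x].
  rewrite in_itv /= => /andP[sx xt]; rewrite derivZ hornerZ.
  rewrite (deriv_chebyshevT hT) ?mulKf ?pnatr_eq0 //.
  by rewrite (le_lt_trans (cos_geN1 s) sx) (lt_le_trans xt (cos_le1 t)).
have mP : measurable_fun `]cos s, cos t[ (horner P^`()) by exact: measurable_poly.
have mU : measurable_fun `]cos s, cos t[ (chebyshevU n).
  by apply: eq_measurable_fun mP => x; rewrite inE => /UE ->.
rewrite /Rintegral (@eq_integral_itv_bounded _ _ _ (horner P^`())) //.
rewrite (@continuous_FTC2 _ _ (horner P)) //=.
- by rewrite !hornerZ !hT -mulrBr mulrC.
- apply: continuous_subspaceT; exact: continuous_horner.
- split=> [x _||]; first exact: derivable_horner.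
  + by apply: cvg_at_right_filter; exact: continuous_horner.
  + by apply: cvg_at_left_filter; exact: continuous_horner.
- by move=> x _; rewrite derivE.
Qed.

Lemma sin_natpi (R : realType) (n : nat) : sin (n%:R * pi) = 0 :> R.
Proof.
by have := alternatingn (@sinDpi R) n 0; rewrite add0r sin0 mulr0 mulr_natl.
Qed.

(** After multiplication by [2 sin (m pi / (2 d))] the [i]-th term becomes
    [sin (m (i+1) pi / d) - sin (m i pi / d)]. *)
Lemma sum_cos_tau (R : realType) (d m : nat) : (0 < m < d.*2)%N ->
  \sum_(i < d) cos (m%:R * tau R d i.+1) = 0.
Proof.
move=> /andP[m0 md].
have d0 : (0 < d)%N by case: d md.
have dR : d%:R != 0 :> R by rewrite pnatr_eq0 -lt0n.
pose h : R := m%:R * pi / (2 * d%:R).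
have h0 : 0 < h.
  by rewrite divr_gt0 ?mulr_gt0 ?ltr0n ?pi_gt0.
have hpi : h < pi.
  rewrite /h ltr_pdivrMr ?mulr_gt0 ?ltr0n // mulrC ltr_pM2l ?pi_gt0 //.
  by rewrite -natrM ltr_nat mul2n.
have sh : sin h *+ 2 != 0 by rewrite mulrn_eq0 /= gt_eqF // sin_gt0_pi // h0.
apply: (mulIf sh); rewrite mul0r mulr_suml.
pose u i := sin (m%:R * (i%:R * pi / d%:R) : R).
rewrite -[RHS](_ : u d - u 0%N = 0); last first.
  by rewrite /u mulrAC divff // mul1r sin_natpi !mul0r mulr0 sin0 subrr.
rewrite -(telescope_sumr u (leq0n d)) big_mkord; apply: eq_bigr => i _.
have -> : u i.+1 = sin (m%:R * tau R d i.+1 + h).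
  by rewrite /u /tau /h; congr sin; field.
have -> : u i = sin (m%:R * tau R d i.+1 - h).
  by rewrite /u /tau /h -natr1; congr sin; field.
rewrite sinB sinD; ring.
Qed.

Lemma sum_cos_tau_2d (R : realType) (d : nat) : (0 < d)%N ->
  \sum_(i < d) cos (d.*2%:R * tau R d i.+1) = - d%:R.
Proof.
move=> d0; have dR : d%:R != 0 :> R by rewrite pnatr_eq0 -lt0n.
rewrite (eq_bigr (fun=> -1)) => [|i _]; last first.
  (* [2 d tau = (2 i + 1) pi], as the index [i] starts from [0]. *)
  have -> : d.*2%:R * tau R d i.+1 = pi + (pi *+ 2) *+ i.
    by rewrite /tau -mul2n natrM -mulr_natr -[pi *+ 2]mulr_natr -natr1; field.
  by rewrite (periodicn (@cosD2pi R)) cospi.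
by rewrite sumr_const card_ord mulNrn.
Qed.

Lemma sum_sin_tau (R : realType) (d j k : nat) :
  (0 < j <= d)%N -> (0 < k <= d)%N ->
  \sum_(i < d) sin (j%:R * tau R d i.+1) * sin (k%:R * tau R d i.+1) =
  if j == k then (if (j < d)%N then d%:R / 2 else d%:R) else 0.
Proof.
wlog kj : j k / (k <= j)%N => [hw|] hj hk.
  have [kj|/ltnW jk] := leqP k j; first exact: hw.
  under eq_bigr do rewrite mulrC.
  by rewrite hw // eq_sym; case: eqP => // ->.
move: hj hk => /andP[j0 jd] /andP[k0 kd].
have -> : \sum_(i < d) sin (j%:R * tau R d i.+1) * sin (k%:R * tau R d i.+1) =
  (\sum_(i < d) cos ((j - k)%:R * tau R d i.+1) -
   \sum_(i < d) cos ((j + k)%:R * tau R d i.+1)) / 2.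
  rewrite -sumrB mulr_suml; apply: eq_bigr => i _.
  rewrite natrB // natrD [(_ - _) * tau _ _ _]mulrBl.
  rewrite [(_ + _) * tau _ _ _]mulrDl cosB cosD.
  by field.
case: eqVneq => [<-|njk].
  rewrite subnn addnn; under eq_bigr do rewrite mul0r cos0.
  rewrite sumr_const card_ord.
  case: ltnP => [lt_jd|dj].
    by rewrite sum_cos_tau ?subr0 // double_gt0 j0 ltn_double.
  have -> : j = d by apply/eqP; rewrite eqn_leq jd.
  by rewrite sum_cos_tau_2d ?(leq_trans j0) //; field.
have ltkj : (k < j)%N by rewrite ltn_neqAle eq_sym njk.
rewrite !sum_cos_tau ?subrr ?mul0r //.
  by rewrite addn_gt0 j0 -addnn -addnS leq_add // (leq_trans ltkj).
rewrite subn_gt0 ltkj (leq_ltn_trans (leq_subr k j)) //.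
by rewrite (leq_ltn_trans jd) // -addnn -[ltnLHS]addn0 ltn_add2l (leq_trans j0).
Qed.

Lemma tau_gt0_ltpi (R : realType) (d : nat) (i : 'I_d) : 0 < tau R d i.+1 < pi.
Proof.
have d0 : (0 < d)%N := leq_ltn_trans (leq0n i) (ltn_ord i).
have idR : i%:R + 1 <= d%:R :> R by rewrite natr1 ler_nat.
have iR : 0 <= i%:R :> R by [].
have p0 := pi_gt0 R.
rewrite /tau -natr1 divr_gt0 ?mulr_gt0 ?ltr0n //=; last by lra.
by rewrite ltr_pdivrMr ?ltr0n // mulrC ltr_pM2l //; lra.
Qed.

Lemma V_sinE (R : realType) (d : nat) (rho : R) (i j : 'I_d) :
  0 < rho < pi ->
  V d rho i j =
    2 / j.+1%:R * sin (j.+1%:R * tau R d i.+1) * sin (j.+1%:R * rho).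
Proof.
move=> rhopi; rewrite mxE integral_chebyshevU; last first.
  have := mulr_gt0 (sin_gt0_pi (tau_gt0_ltpi R i)) (sin_gt0_pi rhopi).
  by rewrite cosB cosD; lra.
by rewrite mulrBr cosB mulrDr cosD; field; rewrite addrC natr1 pnatr_eq0.
Qed.

Lemma gram_VE (R : realType) (d : nat) (rho : R) (j k : 'I_d) :
  0 < rho < pi ->
  ((V d rho)^T *m V d rho) j k =
    (2 / j.+1%:R * sin (j.+1%:R * rho)) * (2 / k.+1%:R * sin (k.+1%:R * rho)) *
    if j == k then (if (j.+1 < d)%N then d%:R / 2 else d%:R) else 0.
Proof.
move=> rhopi; rewrite mxE -(inj_eq val_inj) -eqSS /=.
rewrite -sum_sin_tau ?ltn_ord // mulr_sumr; apply: eq_bigr => i _.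
by rewrite mxE !V_sinE //; ring.
Qed.

Theorem proposition3p1 (R : realType) (d : nat) (rho : R)
    (d_ge1 : (1 <= d)%N) (rho_gt0 : 0 < rho) (rho_ltpi : rho < pi) :
  [/\ forall i j : 'I_d,
        V d rho i j =
          2 / j.+1%:R * sin (j.+1%:R * tau R d i.+1) * sin (j.+1%:R * rho),
      is_diag_mx ((V d rho)^T *m V d rho)
    & forall i : 'I_d,
        ((V d rho)^T *m V d rho) i i =
          if (i.+1 < d)%N
          then 2 * d%:R / i.+1%:R ^+ 2 * sin (i.+1%:R * rho) ^+ 2
          else 4 * d%:R / i.+1%:R ^+ 2 * sin (i.+1%:R * rho) ^+ 2].
Proof.
have rhopi : 0 < rho < pi by rewrite rho_gt0.
split=> [i j||i]; first exact: V_sinE.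
  apply/is_diag_mxP => i j nij; rewrite gram_VE // ifN ?mulr0 //.
have i0 : i.+1%:R != 0 :> R by rewrite pnatr_eq0.
by rewrite gram_VE // eqxx; case: ifP => _; field; rewrite addrC natr1.
Qed.
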